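(* Let $\rho=\frac{1}{\sqrt{3}}$ and let $\mathbb{T}^2_\rho=(\mathbb{R}/2\pi\mathbb{Z})\times(\mathbb{R}/2\rho\pi\mathbb{Z})$ be the flat torus. Then there exists an eigenfunction of the Laplace-Beltrami operator $-\Delta$ on $\mathbb{T}^2_\rho$ with (exactly) three nodal domains.
   Context: For $\rho\in(0,1]$, the torus $\mathbb{T}^2_\rho=(\mathbb{R}/2\pi\mathbb{Z})\times(\mathbb{R}/2\rho\pi\mathbb{Z})$ is viewed as a two-dimensional Riemannian manifold with the flat metric, and $-\Delta$ is its non-negative Laplace-Beltrami operator. Eigenfunctions are real-valued (and not identically zero). The eigenvalues are $\lambda_{m,n}=m^2+\frac{n^2}{\rho^2}$ with $m,n$ non-negative integers, and the eigenspace of an eigenvalue $\lambda$ is spanned by the non-zero functions among $\cos(mx_1)\cos(nx_2/\rho)$, $\cos(mx_1)\sin(nx_2/\rho)$, $\sin(mx_1)\cos(nx_2/\rho)$, $\sin(mx_1)\sin(nx_2/\rho)$, over all pairs $(m,n)$ of non-negative integers with $\lambda=m^2+\frac{n^2}{\rho^2}$. For an eigenfunction $u$, the nodal set is the closed set $\mathcal{N}(u)=u^{-1}(\{0\})$, and a nodal domain of $u$ is a connected component of $\mathbb{T}^2_\rho\setminus\mathcal{N}(u)$. *)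

(* Defs.v *)
From HB Require Import structures.
From mathcomp Require Import all_boot all_order all_algebra.
From mathcomp Require Import all_classical all_reals all_analysis.
Import Order.TTheory GRing.Theory Num.Theory.
Import numFieldNormedType.Exports.

Set Implicit Arguments.
Unset Strict Implicit.
Unset Printing Implicit Defensive.

Local Open Scope classical_set_scope.
Local Open Scope ring_scope.
Local Open Scope quotient_scope.
Local Open Scope card_scope.

Section Circle.
Variables (R : realType) (L : R).

Definition eqmod (x y : R) : bool := `[< exists k : int, x - y = k%:~R * L >].

Lemma eqmod_refl : reflexive eqmod.
Proof. by move=> x; apply/asboolP; exists 0; rewrite subrr mul0r. Qed.

Lemma eqmod_sym : symmetric eqmod.
Proof.
suff H x y : eqmod x y -> eqmod y x by move=> x y; apply/idP/idP => /H.
move=> /asboolP[k xy]; apply/asboolP; exists (- k).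
by rewrite -opprB xy mulrNz mulNr.
Qed.

Lemma eqmod_trans : transitive eqmod.
Proof.
move=> y x z /asboolP[k xy] /asboolP[l yz]; apply/asboolP; exists (k + l).
by rewrite -(subrKA y) xy yz intrD mulrDl.
Qed.

Canonical eqmod_equiv := EquivRel eqmod eqmod_refl eqmod_sym eqmod_trans.

Definition circle := quotient_topology {eq_quot eqmod_equiv}.

HB.instance Definition _ := Topological.on circle.
HB.instance Definition _ := Quotient.on circle.

Lemma circle_piP (x y : R) :
  \pi_circle x = \pi_circle y <-> exists k : int, x - y = k%:~R * L.
Proof.
split=> [/(@eqmodP _ eqmod_equiv) /asboolP //|xy].
by apply/(@eqmodP _ eqmod_equiv)/asboolP.
Qed.

End Circle.

Section Torus.
Variables (R : realType) (rho : R).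

Definition torus : Type := (circle (2 * pi : R) * circle (2 * rho * pi))%type.

HB.instance Definition _ := Topological.on torus.

Definition torus_proj (z : R * R) : torus :=
  (\pi_(circle (2 * pi)) z.1, \pi_(circle (2 * rho * pi)) z.2).

Definition torus_repr (p : torus) : R * R := (repr p.1, repr p.2).

Lemma torus_reprK : cancel torus_repr torus_proj.
Proof. by case=> a b; rewrite /torus_proj /= !reprK. Qed.

End Torus.

Section Laplacian.
Variable R : realType.
Implicit Type f : R * R -> R.

(* [partial true] is the derivative in the first variable, [partial false]
   the one in the second *)
Definition partial (i : bool) f : R * R -> R :=
  fun z => 'D_(if i then (1, 0) else (0, 1)) f z.

(* [s] lists the directions of an iterated mixed partial derivative. *)
Definition smooth f : Prop :=
  forall s : seq bool, let g := foldr partial f s in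
    continuous g /\
    forall z, derivable g z (1, 0) /\ derivable g z (0, 1).

Definition laplacian f : R * R -> R :=
  fun z => partial true (partial true f) z + partial false (partial false f) z.

End Laplacian.

Section Eigenfunctions.
Variables (R : realType) (rho : R).
Implicit Type u : torus rho -> R.

(* The metric is the one that makes [torus_proj] a local isometry from the
   Euclidean plane, so functions on the torus are differentiated through their
   lift to the plane. The value does not depend on the choice of
   representative, see [laplace_beltrami_proj]. *)
Definition laplace_beltrami u : torus rho -> R :=
  fun p => laplacian (u \o @torus_proj R rho) (torus_repr p).

Definition eigenfunction_for (lambda : R) u : Prop :=
  [/\ smooth (u \o @torus_proj R rho),
      exists p, u p != 0
    & forall p, - laplace_beltrami u p = lambda * u p].

Definition eigenfunction u : Prop := exists lambda, eigenfunction_for lambda u.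

Definition nodal_set u : set (torus rho) := u @^-1` [set 0].

Definition nodal_domains u : set (set (torus rho)) :=
  [set connected_component (~` nodal_set u) p | p in ~` nodal_set u].

Lemma partial_periodic i (f : R * R -> R) (w : R * R) :
  (forall z, f (z + w) = f z) ->
  forall z, partial i f (z + w) = partial i f z.
Proof.
move=> fw z; rewrite /partial /derive fw.
by have -> : f \o shift (z + w) = f \o shift z
  by apply/funext => h /=; rewrite addrA fw.
Qed.

Lemma laplace_beltrami_proj u (z : R * R) :
  laplace_beltrami u (torus_proj rho z) = laplacian (u \o @torus_proj R rho) z.
Proof.
rewrite /laplace_beltrami; set z' := torus_repr _.
have zz' : torus_proj rho z' = torus_proj rho z by rewrite torus_reprK.
have lift_periodic y : (u \o @torus_proj R rho) (y + (z' - z)) =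
                       (u \o @torus_proj R rho) y.
  case: zz' => /circle_piP[k zk] /circle_piP[l zl] /=; congr u.
  congr pair; apply/circle_piP; rewrite /= addrC addKr.
    by exists k.
  by exists l.
have <- : z + (z' - z) = z' by rewrite addrC subrK.
have lift_periodic2 i := partial_periodic i lift_periodic.
by rewrite /laplacian !(partial_periodic _ (lift_periodic2 _)).
Qed.

End Eigenfunctions.

(* Main.v *)
(** With c = cos x and d = cos (sqrt 3 y), take the eigenfunction
    u = cos (2x) + 2 cos x cos (sqrt 3 y) = 2c(c + d) - 1 for the eigenvalue 4.
    Where u > 0, c does not vanish; the part of {u > 0} where c > 0 is
    star-shaped about the origin in the coordinates (x, sqrt 3 y), since moving
    towards the origin increases both cosines, and the part where c < 0 is its
    translate by (pi, pi). The set {u < 0} is connected: moving x to the nearest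
    of the lines x = pi/2, x = -pi/2 scales c by a factor in [0, 1], which keeps
    u < 0; u = -1 on these lines, and the segment sqrt 3 y = pi, |x| <= pi/2
    joins them inside {u < 0}. *)
Require Import Defs.
From mathcomp Require Import all_boot all_order all_algebra.
From mathcomp Require Import all_classical all_reals all_analysis.
From mathcomp Require Import ring lra.
Import Order.TTheory GRing.Theory Num.Theory.
Import numFieldNormedType.Exports.
Local Open Scope classical_set_scope.
Local Open Scope ring_scope.
Local Open Scope card_scope.

Set Implicit Arguments.
Unset Strict Implicit.
Unset Printing Implicit Defensive.

(** * Components of a disjoint union of open connected sets *)

Lemma connected_component_open_partition (T : topologicalType) (n : nat)
    (D : 'I_n -> set T) :
  (forall i, open (D i)) -> (forall i, connected (D i)) ->
  trivIset setT D ->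
  forall i p, D i p -> connected_component (\bigcup_j D j) p = D i.
Proof.
move=> oD cD tD i p Dip; apply/seteqP; split; last first.
  by apply: connected_component_max => //; exact: bigcup_sup.
move=> q Cq; set C := connected_component _ p in Cq.
(* The trace of [D i] on the connected set [C] is nonempty, relatively open and relatively closed,
   hence all of [C]. *)
suff CDi : C `&` D i = C by move: Cq; rewrite -CDi => -[].
apply: component_connected.
- by exists p; split=> //; apply: connected_component_refl; exists i.
- by exists (D i).
(* Closedness: inside the union, [D i] is the complement of the other pieces, whose union is
   open. *)
exists (~` \bigcup_(j in [set~ i]) D j).
  by apply: open_closedC; apply: bigcup_open => j _; exact: oD.
apply/seteqP; split=> x [Cx Dx]; split=> //.
  by move=> [j /= ji Djx]; apply: ji; apply: (tD j i) => //; exists x.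
have [j _ Djx] := connected_component_sub Cx.
have [<-//|/eqP ji] := eqVneq j i.
by case: Dx; exists j.
Qed.

Lemma card_components_open_partition (T : topologicalType) (n : nat)
    (D : 'I_n -> set T) :
  (forall i, open (D i)) -> (forall i, connected (D i)) ->
  (forall i, D i !=set0) -> trivIset setT D ->
  [set connected_component (\bigcup_j D j) p | p in \bigcup_j D j] #= `I_n.
Proof.
move=> oD cD D0 tD.
have -> : [set connected_component (\bigcup_j D j) p | p in \bigcup_j D j]
    = D @` setT.
  apply/seteqP; split=> A /=.
    by move=> [p [i _ Dip] <-]; exists i => //;
      rewrite (connected_component_open_partition oD cD tD Dip).
  move=> [i _ <-]; have [p Dip] := D0 i; exists p; first by exists i.
  by rewrite (connected_component_open_partition oD cD tD Dip).
apply: card_eq_trans (card_esym card_II); apply: inj_card_eq => i j _ _ Dij.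
by have [p Dip] := D0 i; apply: tD => //; exists p; rewrite -Dij.
Qed.

(** * Plane waves and their derivatives *)

Section Waves.
Variable R : realType.
Implicit Types (f : R * R -> R) (z v : R * R).

(** The phase [ga] keeps the family closed under differentiation: as -sin s = cos (s + pi/2), a
    derivative only rescales the amplitude and adds pi/2 to the phase. *)
Definition wave (a al be ga : R) z : R := a * cos (al * z.1 + be * z.2 + ga).

Lemma is_derive_scale (f : R -> R) (x c df : R) :
  is_derive x 1 f df -> is_derive x c f (c * df).
Proof.
move=> [fx <-]; have dfx : differentiable f x by apply/derivable1_diffP.
apply: DeriveDef; first exact: diff_derivable.
by rewrite !deriveE // -{1}(mulr1 c) linearZ.
Qed.

Lemma is_derive_wave a al be ga z v :
  is_derive z v (wave a al be ga)
    (wave (a * (al * v.1 + be * v.2)) al be (ga + pi / 2) z).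
Proof.
set c := al * v.1 + be * v.2; set s := al * z.1 + be * z.2 + ga.
have : is_derive s c (a \*: (@cos R)) (wave (a * c) al be (ga + pi / 2) z).
  have := @is_deriveZ _ _ _ _ a _ _ _ (is_derive_scale c (is_derive_cos s)).
  by rewrite /wave addrA cosDpihalf -mulrA.
(* Both derivatives are limits of one and the same difference quotient. *)
have E : (fun h : R => h^-1 *: ((wave a al be ga \o shift z) (h *: v) -
                              wave a al be ga z)) =
         (fun h : R => h^-1 *: (((a \*: (@cos R)) \o shift s) (h *: c) -
                              (a \*: (@cos R)) s)).
  apply/funext => h /=; rewrite /wave /=; congr (_ *: (_ * cos _ - _)).
  by rewrite /s /c /GRing.scale /=; ring.
by move=> [c1 c2]; split; rewrite /derivable /derive E.
Qed.

Lemma continuous_wave a al be ga : continuous (wave a al be ga).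
Proof.
move=> z; apply: cvgM; first exact: cvg_cst.
apply: continuous_comp; last exact: continuous_cos.
apply: cvgD; last exact: cvg_cst.
by apply: cvgD; apply: cvgM;
  [exact: cvg_cst|exact: cvg_fst|exact: cvg_cst|exact: cvg_snd].
Qed.

(** A class stable under [partial], so that [smooth], a condition on all iterated partials, reduces
    to continuity and derivability of its members. *)
Inductive wave_sum : (R * R -> R) -> Prop :=
| wave_sum1 a al be ga : wave_sum (wave a al be ga)
| wave_sumD f g : wave_sum f -> wave_sum g -> wave_sum (f + g).

Lemma continuous_wave_sum f : wave_sum f -> continuous f.
Proof.
elim=> [????|g h _ cg _ ch z]; first exact: continuous_wave.
by apply: cvgD; [exact: cg|exact: ch].
Qed.

Lemma derivable_wave_sum f z v : wave_sum f -> derivable f z v.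
Proof.
elim=> [a al be ga|g h _ dg _ dh]; last exact: derivableD.
by have [] := is_derive_wave a al be ga z v.
Qed.

Lemma partial_wave i a al be ga : partial i (wave a al be ga) =
  wave (a * (if i then al else be)) al be (ga + pi / 2).
Proof.
apply/funext => z; rewrite /partial.
have [_ ->] := is_derive_wave a al be ga z (if i then (1, 0) else (0, 1)).
by case: i => /=; rewrite !mulr1 !mulr0 ?addr0 ?add0r.
Qed.

Lemma partialD i f g : wave_sum f -> wave_sum g ->
  partial i (f + g) = partial i f + partial i g.
Proof.
move=> wf wg; apply/funext => z.
by rewrite /partial deriveD //; exact: derivable_wave_sum.
Qed.

Lemma wave_sum_partial i f : wave_sum f -> wave_sum (partial i f).
Proof.
elim=> [????|g h wg IHg wh IHh]; first by rewrite partial_wave; constructor.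
by rewrite partialD //; constructor.
Qed.

Lemma smooth_wave_sum f : wave_sum f -> smooth f.
Proof.
move=> wf s; have ws : wave_sum (foldr (@partial R) f s).
  by elim: s => //= i s; exact: wave_sum_partial.
split; first exact: continuous_wave_sum.
by move=> z; split; exact: derivable_wave_sum.
Qed.

Lemma laplacian_wave a al be ga z :
  laplacian (wave a al be ga) z = - (al ^+ 2 + be ^+ 2) * wave a al be ga z.
Proof.
(* Two derivatives shift the phase by pi in total, which changes the sign of the cosine. *)
rewrite /laplacian !partial_wave /wave !addrA -(addrA _ _ (pi / 2)) -splitr cosDpi.
ring.
Qed.

Lemma laplacianD f g z : wave_sum f -> wave_sum g ->
  laplacian (f + g) z = laplacian f z + laplacian g z.
Proof.
move=> wf wg; rewrite /laplacian !(partialD _ wf wg).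
by rewrite !(partialD _ (wave_sum_partial _ wf) (wave_sum_partial _ wg)) [LHS]addrACA.
Qed.

End Waves.

(** * Periodicity and monotonicity of the cosine *)

Lemma cosD_int2pi (R : realType) (x : R) (n : int) :
  cos (x + n%:~R * (2 * pi)) = cos x.
Proof.
case: n => n.
  by rewrite -pmulrn mulr_natl mulr_natl (periodicn (@cosD2pi R)).
rewrite NegzE mulrNz mulNr -(periodicn (@cosD2pi R) n.+1 (x - _)).
by rewrite -pmulrn mulr_natl mulr_natl subrK.
Qed.

Lemma le_cos_norm (R : realType) (x y : R) :
  `|x| <= `|y| -> `|y| <= pi -> cos y <= cos x.
Proof.
rewrite -(cos_norm x) -(cos_norm y); have := normr_ge0 x; have := normr_ge0 y.
move: `|x| `|y| => a b b0 a0 ab bpi.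
move: ab; rewrite le_eqVlt => /orP[/eqP->//|ab]; apply/ltW.
by rewrite ltr_cos // in_itv /= ?a0 ?b0 //= (le_trans (ltW ab)).
Qed.

Lemma cos_segment_pihalf (R : realType) (a t : R) :
  0 <= a <= pi -> 0 <= t <= 1 ->
  exists2 s, 0 <= s <= 1 & cos (a + t * (pi / 2 - a)) = s * cos a.
Proof.
move=> /andP[a0 api] /andP[t0 t1].
wlog apih : a a0 api / a <= pi / 2.
  (* The reflection of x to pi - x fixes pi/2 and negates both cosines, so the same factor [s]
     serves. *)
  move=> W; have [/W|pih_a] := leP a (pi / 2); first exact.
  have [||//|s s01 Es] := W (pi - a); [lra|lra|lra|exists s => //].
  have cosB x : cos (pi - x) = - cos x :> R by rewrite addrC cosDpi cosN.
  rewrite cosB mulrN in Es; rewrite -[RHS]opprK -Es -cosB.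
  by congr cos; field.
set b := a + _.
have pi0 := pi_gt0 R.
have ab : 0 <= t * (pi / 2 - a) by rewrite mulr_ge0 // subr_ge0.
have bpi : t * (pi / 2 - a) <= pi / 2 - a by rewrite ler_piMl // subr_ge0.
have b0 : 0 <= cos b by apply: cos_ge0_pihalf; apply/andP; split; rewrite /b; lra.
have ba : cos b <= cos a by apply: le_cos_norm; rewrite !ger0_norm /b; lra.
(* The factor is the quotient of the cosines; if cos a = 0, then cos b is squeezed to 0 and any
   factor would do. *)
have [ca|ca] := eqVneq (cos a) 0.
  exists 0; first by rewrite lexx ler01.
  by rewrite mul0r; apply/le_anti; rewrite b0 -ca ba.
have ca0 : 0 < cos a by rewrite lt_neqAle eq_sym ca (le_trans b0).
exists (cos b / cos a); last by rewrite divfK.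
by rewrite ler_pdivrMr // mul1r ba andbT divr_ge0 // ltW.
Qed.

Lemma int_shift_itv (R : realType) (L a x : R) : 0 < L ->
  exists n : int, a <= x + n%:~R * L <= a + L.
Proof.
move=> L0; exists (- Num.floor ((x - a) / L)).
have := floor_itv ((x - a) / L); rewrite intrD mulrNz => /andP[].
set m := _%:~R; rewrite ler_pdivlMr // ltr_pdivrMr // mulrDl mul1r => h1 h2.
by rewrite mulNr; apply/andP; split; lra.
Qed.

(** * Periodic functions on the circle *)

Section CircleFunctions.
Variables (R : realType) (L : R) (g : R -> R).
Hypothesis g_periodic : forall x (n : int), g (x + n%:~R * L) = g x.
Local Open Scope quotient_scope.

Lemma periodic_repr_pi x : g (repr (\pi_(circle L) x)) = g x.
Proof.
have /circle_piP[n xn] : \pi_(circle L) (repr (\pi_(circle L) x)) = \pi_(circle L) x.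
  by rewrite reprK.
by rewrite -(g_periodic x n) -xn addrC subrK.
Qed.

(** [repr] is an arbitrary choice of representatives, with no continuity of its own; periodicity
    makes [g] constant on classes, so the composite is the map induced on the quotient. *)
Lemma continuous_periodic_repr : continuous g ->
  continuous (g \o repr : circle L -> R).
Proof.
move=> cg; apply: repr_comp_continuous => // x y /eqP/circle_piP[n xn].
by rewrite -(g_periodic y n) -xn addrC subrK.
Qed.

End CircleFunctions.

(** * Connectedness through paths *)

Lemma connected_joined (T : topologicalType) (D : set T) p :
  (forall q, D q -> connected_component D p q) -> connected D.
Proof.
move=> pD; suff <- : connected_component D p = D by exact: component_connected.
by apply/seteqP; split=> [|q /pD //]; exact: connected_component_sub.
Qed.

Lemma path_joined (R : realType) (T : topologicalType) (D : set T) (g : R -> T) :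
  continuous g -> (forall t, 0 <= t <= 1 -> D (g t)) ->
  connected_component D (g 0) (g 1).
Proof.
move=> cg gD; apply: (@connected_component_max _ _ (g @` `[0, 1])).
- by exists 0 => //; rewrite /= in_itv /= lexx ler01.
- by move=> _ [t + <-]; rewrite /= in_itv /=; exact: gD.
- apply: connected_continuous_connected; first exact: segment_connected.
  exact: continuous_subspaceT.
- by exists 1 => //; rewrite /= in_itv /= lexx ler01.
Qed.

(** * The eigenfunction and coordinates on the torus *)

Section HexagonalWave.
Variable R : realType.
Local Notation k := (Num.sqrt 3 : R).
Local Notation rho := (1 / k).
Local Notation T := (torus rho).
Local Open Scope quotient_scope.

Let k_gt0 : 0 < k. Proof. by rewrite sqrtr_gt0. Qed.
Let k_sqr : k ^+ 2 = 3. Proof. by rewrite sqr_sqrtr. Qed.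
Let k_period : k * (2 * rho * pi) = 2 * pi.
Proof. by field; rewrite gt_eqF. Qed.

Definition cos1 (p : T) : R := cos (repr p.1).
Definition cos2 (p : T) : R := cos (k * repr p.2).
Definition hex (p : T) : R := 2 * cos1 p * (cos1 p + cos2 p) - 1.

(** Rescaling the second coordinate gives both cosines the period 2 pi, so that [hex] becomes an
    expression in cos z.1 and cos z.2. *)
Definition chart (z : R * R) : T := torus_proj rho (z.1, z.2 / k).

Let cosk_periodic x (n : int) :
  cos (k * (x + n%:~R * (2 * rho * pi))) = cos (k * x).
Proof. by rewrite mulrDr mulrCA k_period cosD_int2pi. Qed.

Lemma cos1_proj z : cos1 (torus_proj rho z) = cos z.1.
Proof. exact: (periodic_repr_pi (@cosD_int2pi R)). Qed.

Lemma cos2_proj z : cos2 (torus_proj rho z) = cos (k * z.2).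
Proof. exact: (@periodic_repr_pi _ _ (fun x => cos (k * x))). Qed.

Lemma cos2_chart z : cos2 (chart z) = cos z.2.
Proof. by rewrite cos2_proj /= mulrC divfK // gt_eqF. Qed.

Lemma hex_chart z : hex (chart z) = 2 * cos z.1 * (cos z.1 + cos z.2) - 1.
Proof. by rewrite /hex cos2_chart cos1_proj. Qed.

Lemma continuous_cos1 : continuous cos1.
Proof.
move=> p; have -> : cos1 = (@cos R \o repr) \o fst by [].
apply: continuous_comp; first exact: cvg_fst.
by apply: continuous_periodic_repr; [exact: cosD_int2pi|exact: continuous_cos].
Qed.

Lemma continuous_cos2 : continuous cos2.
Proof.
move=> p; have -> : cos2 = ((fun x => cos (k * x)) \o repr) \o snd by [].
apply: continuous_comp; first exact: cvg_snd.
apply: continuous_periodic_repr => // x.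
apply: continuous_comp; last exact: continuous_cos.
by apply: cvgM; [exact: cvg_cst|exact: cvg_id].
Qed.

Lemma continuous_hex : continuous hex.
Proof.
move=> p; apply: cvgB; last exact: cvg_cst.
apply: cvgM; first by apply: cvgM; [exact: cvg_cst|exact: continuous_cos1].
by apply: cvgD; [exact: continuous_cos1|exact: continuous_cos2].
Qed.

Lemma continuous_chart : continuous chart.
Proof.
move=> z; pose f1 := \pi_(circle (2 * pi : R)).
pose f2 := \pi_(circle (2 * rho * pi)) \o (fun y : R => y / k).
have cf2 : continuous f2.
  move=> y; apply: continuous_comp; last exact: pi_continuous.
  by apply: cvgM; [exact: cvg_id|exact: cvg_cst].
apply: (@cvg_pair _ _ _ _ (nbhs (f1 z.1)) (nbhs (f2 z.2)) _ _ _
  (f1 \o fst) (f2 \o snd)).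
  by apply: continuous_comp; [exact: cvg_fst|exact: pi_continuous].
by apply: continuous_comp; [exact: cvg_snd|exact: cf2].
Qed.

(** The corner of the period square is left free: the positive domains use a square centred at the
    peak of [hex], the negative one a square with z.1 between -pi and pi. *)
Lemma chart_surj a b p : exists z,
  [/\ a <= z.1 <= a + 2 * pi, b <= z.2 <= b + 2 * pi & p = chart z].
Proof.
have L0 : 0 < 2 * pi :> R by rewrite mulr_gt0 // pi_gt0.
have [n xn] := int_shift_itv a (repr p.1) L0.
have [m ym] := int_shift_itv b (k * repr p.2) L0.
exists (repr p.1 + n%:~R * (2 * pi), k * repr p.2 + m%:~R * (2 * pi)).
split=> //.
rewrite -[LHS]torus_reprK; congr pair; apply/circle_piP => /=.
  by exists (- n); rewrite mulrNz mulNr; ring.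
by exists (- m); rewrite mulrNz; field; rewrite gt_eqF.
Qed.

Lemma segment_joined (D : set T) (z w : R * R) :
  (forall t, 0 <= t <= 1 ->
     D (chart (z.1 + t * (w.1 - z.1), z.2 + t * (w.2 - z.2)))) ->
  connected_component D (chart z) (chart w).
Proof.
move=> zwD; pose g t := chart (z.1 + t * (w.1 - z.1), z.2 + t * (w.2 - z.2)).
have at0 (x y : R) : x + 0 * (y - x) = x by ring.
have at1 (x y : R) : x + 1 * (y - x) = y by ring.
have -> : chart z = g 0 by rewrite /g !at0 -surjective_pairing.
have -> : chart w = g 1 by rewrite /g !at1 -surjective_pairing.
apply: path_joined => // t; apply: continuous_comp; last exact: continuous_chart.
have c1 (x y : R) : continuous (fun t : R => x + t * (y - x)).
  by move=> s; apply: cvgD; [|apply: cvgM]; [exact: cvg_cst|exact: cvg_id|exact: cvg_cst].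
exact: (@cvg_pair _ _ _ _ (nbhs _) (nbhs _) _ _ _ _ _ (c1 _ _ t) (c1 _ _ t)).
Qed.

(** * Connectedness of the nodal domains *)

Definition pos_domain (e : R) : set T := [set p | 0 < hex p /\ 0 < e * cos1 p].
Definition neg_domain : set T := [set p | hex p < 0].

(** The centre [b] is 0 for [e] = 1 and pi for [e] = -1. Recentring at (b, b) multiplies both
    cosines by [e], and [hex] only sees the square of [e], so one star-shapedness argument covers
    both signs. *)
Lemma connected_pos_domain (b e : R) : e ^+ 2 = 1 ->
  (forall x, cos (b + x) = e * cos x) -> connected (pos_domain e).
Proof.
move=> e2 be; apply: (@connected_joined _ _ (chart (b, b))) => q Dq.
have [z [z1 z2 qz]] := chart_surj (b - pi) (b - pi) q; move: Dq; rewrite qz.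
have Dchart x y : pos_domain e (chart (b + x, b + y)) <->
    0 < cos x /\ 0 < 2 * cos x * (cos x + cos y) - 1.
  rewrite /pos_domain /= hex_chart cos1_proj /= !be.
  have -> : e * (e * cos x) = e ^+ 2 * cos x by ring.
  have -> : 2 * (e * cos x) * (e * cos x + e * cos y) =
    e ^+ 2 * (2 * cos x * (cos x + cos y)) by ring.
  by rewrite e2 !mul1r andC.
have -> : z = (b + (z.1 - b), b + (z.2 - b)).
  by rewrite ![b + _]addrC !subrK -surjective_pairing.
have : `|z.1 - b| <= pi by rewrite ler_norml; apply/andP; split; lra.
have : `|z.2 - b| <= pi by rewrite ler_norml; apply/andP; split; lra.
move: (z.1 - b) (z.2 - b) => x y ypi xpi /Dchart[x0 xy0].
apply: segment_joined => t /andP[t0 t1].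
rewrite [_ + _ * _](_ : _ = b + t * x) /=; last by ring.
rewrite [X in (_, X)](_ : _ = b + t * y); last by ring.
have norm_le s : `|t * s| <= `|s| by rewrite normrM ger0_norm // ler_piMl.
have cx := le_cos_norm (norm_le x) xpi.
have cy := le_cos_norm (norm_le y) ypi.
apply: (Dchart _ _).2; move: (cos x) (cos y) (cos (t * x)) (cos (t * y)) x0 xy0 cx cy.
move=> c d c' d' c0 cd0 cc' dd'; split; first exact: lt_le_trans cc'.
(* [d] may be negative, but the sum is positive since its product with c > 0 exceeds 1/2; this
   allows the two inequalities to be multiplied. *)
have cd : 0 < c + d by rewrite -(pmulr_rgt0 _ c0); lra.
have : c * (c + d) <= c' * (c' + d').
  by apply: ler_pM; [exact: ltW|exact: ltW|exact: cc'|exact: lerD].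
lra.
Qed.


Lemma connected_neg_domain : connected neg_domain.
Proof.
have pi0 := pi_gt0 R.
have joined z w : (forall t, 0 <= t <= 1 ->
      2 * cos (z.1 + t * (w.1 - z.1)) *
      (cos (z.1 + t * (w.1 - z.1)) + cos (z.2 + t * (w.2 - z.2))) < 1) ->
    connected_component neg_domain (chart z) (chart w).
  by move=> zw; apply: segment_joined => t /zw; rewrite /neg_domain /= hex_chart subr_lt0.
pose p0 := chart (pi / 2, pi).
(* Here the second cosine is -1 and c = cos z.1 lies in [0, 1], so 2c(c - 1) <= 0 < 1. *)
have top : connected_component neg_domain (chart (- (pi / 2), pi)) p0.
  apply: joined => t /andP[t0 t1] /=; rewrite subrr mulr0 addr0 cospi.
  have : 0 <= cos (- (pi / 2) + t * (pi / 2 - - (pi / 2))).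
    have : 0 <= t * pi by rewrite mulr_ge0 // ltW.
    have : t * pi <= pi by rewrite ler_piMl // ltW.
    by move=> h1 h2; apply: cos_ge0_pihalf; apply/andP; split; lra.
  have := cos_le1 (- (pi / 2) + t * (pi / 2 - - (pi / 2))).
  by move: (cos _) => c c1 c0; nra.
have side e y : cos (e * (pi / 2)) = 0 ->
    connected_component neg_domain (chart (e * (pi / 2), y))
      (chart (e * (pi / 2), pi)).
  by move=> ce; apply: joined => t _ /=; rewrite subrr mulr0 addr0 ce mulr0 mul0r.
(* Writing the first coordinate as [e] times [a] with [a] in [0, pi] treats both halves of the
   period at once, [e] being a sign. *)
have slide a y e : 0 <= a <= pi -> (forall x, cos (e * x) = cos x) ->
    neg_domain (chart (e * a, y)) ->
    connected_component neg_domain (chart (e * a, y))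
      (chart (e * (pi / 2), y)).
  move=> api ecos; rewrite /neg_domain /= hex_chart /= ecos => hn.
  apply: joined => t t01 /=; rewrite subrr mulr0 addr0.
  have -> : e * a + t * (e * (pi / 2) - e * a) =
    e * (a + t * (pi / 2 - a)) by ring.
  rewrite ecos.
  have [s /andP[s0 s1] ->] := cos_segment_pihalf api t01.
  move: (cos a) (cos y) hn => c d hn.
  (* Since s^2 <= s, 2sc(sc + d) is at most s times 2c(c + d), which stays below 1 because 2c(c + d)
     < 1 and s is in [0, 1]. *)
  have : s * (c * (c + d)) <= s / 2 by apply: ler_wpM2l => //; lra.
  have : s * (s * c ^+ 2) <= s * c ^+ 2.
    by rewrite ler_wpM2l // ler_piMl // sqr_ge0.
  nra.
have all e a y : e = 1 \/ e = - 1 -> 0 <= a <= pi ->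
    neg_domain (chart (e * a, y)) ->
    connected_component neg_domain p0 (chart (e * a, y)).
  move=> e1 api ay; apply: connected_component_sym.
  have ecos x : cos (e * x) = cos x by case: e1 => ->; rewrite ?mul1r ?mulN1r ?cosN.
  apply: (connected_component_trans (slide _ _ _ api ecos ay)).
  apply: (connected_component_trans (side e y _)); first by rewrite ecos cos_pihalf.
  case: e1 => ->; rewrite ?(mulN1r (pi / 2)) ?(mul1r (pi / 2)) //.
  (* For [e] = -1 the last leg was [top]; for [e] = 1 the path already ends at [p0]. *)
  apply: connected_component_refl.
  by rewrite /neg_domain /= hex_chart /= cos_pihalf; lra.
apply: (@connected_joined _ _ p0) => q.
have [[x y] [/= x1 _ ->]] := chart_surj (- pi) 0 q.
have [x0|x0] := leP 0 x.
  by rewrite -(mul1r x); apply: all; [left|lra].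
by rewrite -(opprK x) -mulN1r; apply: all; [right|lra].
Qed.

(** * The eigenvalue equation *)

Lemma hex_projE : hex \o @torus_proj R rho =
  wave 1 2 0 0 + wave 1 1 k 0 + wave 1 1 (- k) 0.
Proof.
have addE (f g : R * R -> R) z : (f + g) z = f z + g z by [].
apply/funext => z; rewrite /= /hex cos1_proj cos2_proj !addE /wave.
(* 2 cos^2 x - 1 = cos 2x, and 2 cos x cos ky = cos (x + ky) + cos (x - ky). *)
rewrite !mul0r !mul1r !addr0 mulNr cosD cosB (mulr_natl z.1) cos_mulr2n; ring.
Qed.

(** The wave vectors (2, 0), (1, k) and (1, -k) all have squared length 4 because k^2 = 3; with
    their opposites they form a regular hexagon. *)
Lemma eigenfunction_hex : eigenfunction hex.
Proof.
have wD := (@wave_sum1 R).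
have w12 : wave_sum (wave 1 2 0 0 + wave 1 1 k 0) by exact: wave_sumD.
exists 4; split.
- by rewrite hex_projE; apply: smooth_wave_sum; exact: wave_sumD.
- exists (chart (0, 0)); rewrite hex_chart /= cos0; apply/eqP; lra.
- have addE (f g : R * R -> R) z : (f + g) z = f z + g z by [].
  move=> p; rewrite -(torus_reprK p) laplace_beltrami_proj.
  set z := torus_repr p; have := congr1 (@^~ z) hex_projE => /= ->.
  rewrite hex_projE !laplacianD // !laplacian_wave sqrrN k_sqr !addE; ring.
Qed.

(** * Counting the nodal domains *)

Lemma nodal_domains_hex : nodal_domains hex #= `I_3.
Proof.
pose D (i : 'I_3) :=
  if i == 0 then pos_domain 1 else
  if i == 1 then pos_domain (- 1) else neg_domain.
have DE : ~` nodal_set hex = \bigcup_i D i.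
  apply/seteqP; split=> p; rewrite /nodal_set /D /=.
    move=> /eqP; rewrite neq_lt => /orP[hn|hp]; first by exists ord_max.
    have [c0|c0|c0] := ltgtP (cos1 p) 0.
    - by exists 1 => //=; rewrite /pos_domain /= mulN1r oppr_gt0.
    - by exists 0 => //=; rewrite /pos_domain /= mul1r.
    (* Where [cos1] vanishes [hex] is -1, so this case contradicts positivity. *)
    - by move: hp; rewrite /hex c0 mulr0 mul0r sub0r oppr_gt0 ltr10.
  move=> [i _]; case: ifP => _; last case: ifP => _; rewrite /pos_domain /neg_domain /=.
  - by move=> [h0 _]; apply/eqP; rewrite gt_eqF.
  - by move=> [h0 _]; apply/eqP; rewrite gt_eqF.
  - by move=> h0; apply/eqP; rewrite lt_eqF.
rewrite /nodal_domains DE; apply: card_components_open_partition.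
- have ogt (f : T -> R) : continuous f -> open (f @^-1` [set x | 0 < x]).
    by move=> cf; apply: open_comp; [move=> p _; exact: cf|exact: open_gt].
  have opos e : open (pos_domain e).
    have -> : pos_domain e = hex @^-1` [set x | 0 < x] `&`
      (fun p => e * cos1 p) @^-1` [set x | 0 < x] by [].
    apply: openI; apply: ogt; first exact: continuous_hex.
    by move=> p; apply: cvgM; [exact: cvg_cst|exact: continuous_cos1].
  have oneg : open neg_domain.
    have -> : neg_domain = hex @^-1` [set x | x < 0] by [].
    by apply: open_comp; [move=> p _; exact: continuous_hex|exact: open_lt].
  by move=> i; rewrite /D; case: ifP => _ //; case: ifP => _.
- move=> i; rewrite /D; case: ifP => _; last case: ifP => _.
  + apply: (@connected_pos_domain 0); first by rewrite expr1n.
    by move=> x; rewrite add0r mul1r.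
  + apply: (@connected_pos_domain pi); first by rewrite sqrrN expr1n.
    by move=> x; rewrite addrC cosDpi mulN1r.
  + exact: connected_neg_domain.
- move=> i; rewrite /D; case: ifP => _; last case: ifP => _.
  (* At the three witnesses [hex] is 3, 3 and -1. *)
  + exists (chart (0, 0)); rewrite /pos_domain /= hex_chart cos1_proj /= cos0; lra.
  + exists (chart (pi, pi)); rewrite /pos_domain /= hex_chart cos1_proj /= cospi; lra.
  + exists (chart (pi / 2, 0)); rewrite /neg_domain /= hex_chart /= cos_pihalf; lra.
(* Distinct pieces disagree on the sign of [hex] or, for the two positive ones, on the sign of
   [cos1]. *)
- move=> i j _ _ [p]; rewrite /D {D DE}; have i3 := ltn_ord i; have j3 := ltn_ord j.
  case: i i3 => -[|[|[|//]]] i3 _; case: j j3 => -[|[|[|//]]] j3 _ /=;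
    rewrite /pos_domain /neg_domain /= => -[Dip Djp];
    try exact/val_inj; exfalso; lra.
Qed.

End HexagonalWave.

Theorem proposition2 (R : realType) :
  exists u : torus (1 / Num.sqrt 3 : R) -> R,
    eigenfunction u /\ nodal_domains u #= `I_3.
Proof.
exists (@hex R); split; [exact: eigenfunction_hex|exact: nodal_domains_hex].
Qed.
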